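(* Let $R$ be a tolerance on a set $U$. Then the disjoint representation $\mathcal{D}(\mathit{RS})$ and the formal concept representation $\mathcal{FC}(\mathit{RS})$ of rough sets are (up to isomorphism) Dedekind--MacNeille completions of the ordered set $\mathit{RS}$.
   Context: A tolerance on $U$ is a reflexive and symmetric binary relation $R$ on $U$; $R(x)=\{y\in U\mid x\,R\,y\}$. For $X\subseteq U$, $X^{\blacktriangledown}=\{x\in U\mid R(x)\subseteq X\}$, $X^{\blacktriangle}=\{x\in U\mid R(x)\cap X\neq\emptyset\}$, $X^c=U\setminus X$. $\wp(U)^{\blacktriangledown}=\{X^{\blacktriangledown}\mid X\subseteq U\}$, and $\mathit{RS}=\{(X^{\blacktriangledown},X^{\blacktriangle})\mid X\subseteq U\}$ is ordered coordinatewise by inclusion. Let $\mathcal{S}=\{x\in U\mid R(x)=\{x\}\}$. The Dedekind--MacNeille completion of an ordered set $P$ is the smallest complete lattice with $P$ order-embedded in it. Disjoint representation: $\mathcal{D}(\mathit{RS})=\{(A,B)\in\wp(U)^{\blacktriangledown}\times\wp(U)^{\blacktriangledown}\mid A^{\blacktriangle}\cap B^{\blacktriangle}=\emptyset\text{ and }\mathcal{S}\subseteq A\cup B\}$, ordered by $(A,B)\le(C,D)$ iff $A\subseteq C$ and $B\supseteq D$. Formal concept representation: let $\mathbb{K}=(U,U,R^c)$ be the formal context with $R^c=(U\times U)\setminus R$. For $X\subseteq U$, $X'=\{x\in U\mid (y,x)\notin R\text{ for all }y\in X\}$. A concept of $\mathbb{K}$ is a pair $(A,B)$ of subsets of $U$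 with $A'=B$ and $B'=A$; its extent is $\mathrm{ext}(A,B)=A$. The concept lattice $\mathfrak{B}(\mathbb{K})$ is the set of all concepts ordered by $(A_1,B_1)\le(A_2,B_2)$ iff $A_1\subseteq A_2$ (equivalently $B_1\supseteq B_2$). The weak opposition of a concept $\alpha=(A,B)$ is $\alpha^{\bigtriangledown}=((B^c)',(B^c)'')$. Then $\mathcal{FC}(\mathit{RS})=\{(\alpha,\beta)\in\mathfrak{B}(\mathbb{K})\times\mathfrak{B}(\mathbb{K})\mid\beta\le\alpha^{\bigtriangledown}\text{ in }\mathfrak{B}(\mathbb{K})\text{ and }\mathcal{S}\subseteq\mathrm{ext}(\alpha)\cup\mathrm{ext}(\beta)\}$, ordered by the order of $\mathfrak{B}(\mathbb{K})\times\mathfrak{B}(\mathbb{K})^{\mathrm{op}}$, where $\mathrm{op}$ denotes the dual order. *)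

(* Defs.v *)
From HB Require Import structures.
From mathcomp Require Import all_boot all_order.
From mathcomp Require Import boolp classical_sets.

Set Implicit Arguments.
Unset Strict Implicit.
Unset Printing Implicit Defensive.

Import Order.TTheory.

Local Open Scope order_scope.
Local Open Scope classical_set_scope.

(* Subtypes of partially ordered types carry the induced order.  In particular RS, the disjoint representation and the
   formal concept representation below are ordered by the order of the product
   type in which they are declared. *)
HB.instance Definition _ d (T : porderType d) (P : pred T) :=
  [SubChoice_isSubPOrder of {x : T | P x} by <: with d].

Definition order_embedding d d' (P : porderType d) (Q : porderType d')
    (e : P -> Q) : Prop :=
  {mono e : x y / x <= y}.

Definition complete_lattice d (L : porderType d) : Prop :=
  forall A : set L, supremums A !=set0 /\ infimums A !=set0.

(* "Smallest" is meant relative to the embedded copy of P: L embeds, over P,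
   into every complete lattice in which P is order-embedded.  The triangle
   g \o e = f cannot be dropped; with it, L is determined up to a unique
   isomorphism over P. *)
Definition is_DM_completion d d' (P : porderType d) (L : porderType d') :
    Prop :=
  complete_lattice L /\
  exists e : P -> L,
    order_embedding e /\
    forall d'' (M : porderType d'') (f : P -> M),
      complete_lattice M -> order_embedding f ->
      exists g : L -> M, order_embedding g /\ g \o e =1 f.

Record tolerance (U : Type) := Tolerance {
  tol_rel :> U -> U -> Prop;
  tol_refl : forall x, tol_rel x x;
  tol_sym : forall x y, tol_rel x y -> tol_rel y x
}.

Section RoughSets.
Context {U : Type}.
Variable R : tolerance U.
Implicit Types X : set U.

Definition nbhd (x : U) : set U := [set y | R x y].

Definition lower X : set U := [set x | nbhd x `<=` X].

Definition upper X : set U := [set x | nbhd x `&` X !=set0].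

Definition singletons : set U := [set x | nbhd x = [set x]].

Definition RS : set (set U *p set U) := range (fun X => (lower X, upper X)).

(* The second factor carries the dual order: (A, B) <= (C, D) iff A is included
   in C and D is included in B. *)
Definition disjoint_repr : set (set U *p (set U)^d) :=
  [set p : set U * set U |
    [/\ range lower p.1, range lower p.2,
        upper p.1 `&` upper p.2 = set0
      & singletons `<=` p.1 `|` p.2]].

(* Derivation in the context (U, U, ~ R); as R is symmetric, the derivations of
   objects and of attributes coincide. *)
Definition derivation X : set U := [set x | forall y, X y -> ~ R y x].

Record concept := Concept {
  extent : set U;
  intent : set U;
  derivation_extent : derivation extent = intent;
  derivation_intent : derivation intent = extent
}.

HB.instance Definition _ := gen_eqMixin concept.
HB.instance Definition _ := gen_choiceMixin concept.

Definition concept_le : rel concept :=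
  fun a b => `[< extent a `<=` extent b >].

Fact concept_le_refl : reflexive concept_le.
Proof. by move=> a; apply/asboolP. Qed.

Fact concept_le_anti : antisymmetric concept_le.
Proof.
move=> [A B AB BA] [C D CD DC] /andP[/asboolP/= AC /asboolP/= CA].
have E : A = C by apply/seteqP.
have F : B = D by rewrite -AB -CD E.
by subst; congr Concept; exact: Prop_irrelevance.
Qed.

Fact concept_le_trans : transitive concept_le.
Proof.
move=> b a c /asboolP ab /asboolP bc; apply/asboolP.
exact: subset_trans ab bc.
Qed.

HB.instance Definition _ := Order.Le_isPOrder.Build set_display concept
  concept_le_refl concept_le_anti concept_le_trans.

Lemma derivation3 X : derivation (derivation (derivation X)) = derivation X.
Proof.
apply/seteqP; split=> x Hx y Xy Ryx.
- by apply: (Hx y) => // z zX Rzy; apply: zX Xy (tol_sym Rzy).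
- by apply: Xy Hx (tol_sym Ryx).
Qed.

Definition weak_opposition (a : concept) : concept :=
  @Concept (derivation (~` intent a)) (derivation (derivation (~` intent a)))
    erefl (derivation3 (~` intent a)).

(* In the membership condition p.2 <= weak_opposition p.1 is read in the concept
   lattice itself; only the resulting pairs are ordered dually in their second
   component. *)
Definition formal_concept_repr : set (concept *p concept^d) :=
  [set p : concept * concept |
    p.2 <= weak_opposition p.1 /\
    singletons `<=` extent p.1 `|` extent p.2].

End RoughSets.

Arguments formal_concept_repr {U} R _.

(* Main.v *)
(** An order embedding e : P -> L with join- and meet-dense image extends any
    embedding f of P into a complete lattice to L by sending l to the supremum
    of the f p with e p <= l; meet density makes this extension reflect the
    order.  Upper and lower approximation are adjoint, so extents of concepts
    are exactly the lower approximations and taking extents identifies FC(RS)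
    with D(RS).  It remains to see that (X_lower, X_upper) |-> (X_lower,
    complement of X_upper) is dense in D(RS); complementing X swaps the two
    components, so that join density suffices. *)

Require Import Defs.
From mathcomp Require Import all_boot all_order boolp classical_sets.

Set Implicit Arguments.
Unset Strict Implicit.
Unset Printing Implicit Defensive.

Import Order.TTheory.

Local Open Scope order_scope.
Local Open Scope classical_set_scope.

(** * Density criterion for Dedekind-MacNeille completions *)

Section DedekindMacNeille.
Context {d d' d'' : Order.disp_t}.
Implicit Types (P : porderType d) (L : porderType d') (M : porderType d'').

(** An infimum of [A] is a supremum of its set of lower bounds. *)
Lemma complete_lattice_supremums L :
  (forall A : set L, supremums A !=set0) -> complete_lattice L.
Proof.
move=> sup A; split; first exact: sup.
have [m [mub mlub]] := sup (lbound A); exists m; split=> //.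
by move=> x Ax; apply: mlub => y; exact.
Qed.

(** Equivalently, each [l] is the supremum of the elements [e p] below it; this form mentions no
    suprema. *)
Definition join_dense P L (e : P -> L) : Prop :=
  forall l m, (forall p, e p <= l -> e p <= m) -> l <= m.

Definition meet_dense P L (e : P -> L) : Prop :=
  forall l m, (forall p, m <= e p -> l <= e p) -> l <= m.

Lemma dense_extension P L M (e : P -> L) (f : P -> M) :
  order_embedding e -> join_dense e -> meet_dense e ->
  complete_lattice M -> order_embedding f ->
  exists g : L -> M, order_embedding g /\ g \o e =1 f.
Proof.
move=> e_mono e_join e_meet M_cplt f_mono.
pose below l := [set f p | p in [set p | e p <= l]].
have [g g_sup] : {g : L -> M & forall l, supremums (below l) (g l)}.
  exists (fun l => sval (cid (M_cplt (below l)).1)) => l.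
  exact: svalP (cid (M_cplt (below l)).1).
have le_g p l : e p <= l -> f p <= g l.
  by move=> epl; apply: (g_sup l).1; exists p.
have g_le p l : l <= e p -> g l <= f p.
  move=> lep; apply: (g_sup l).2 => _ [q /= eql <-].
  by rewrite f_mono -e_mono; exact: le_trans eql lep.
exists g; split=> [l m|p /=]; last first.
  by apply/eqP; rewrite eq_le le_g // g_le.
apply/idP/idP => [glm|lm].
  (* For [e p <= l] and [m <= e q], the chain [f p <= g l <= g m <= f q] is reflected to
     [e p <= e q]. *)
  apply: e_join => p epl; apply: e_meet => q meq.
  rewrite e_mono -f_mono.
  exact: le_trans (le_g _ _ epl) (le_trans glm (g_le _ _ meq)).
apply: (g_sup l).2 => _ [p /= epl <-].
exact: le_g (le_trans epl lm).
Qed.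

End DedekindMacNeille.

Lemma is_DM_completion_dense d d' (P : porderType d) (L : porderType d')
    (e : P -> L) :
  complete_lattice L -> order_embedding e -> join_dense e -> meet_dense e ->
  is_DM_completion P L.
Proof.
move=> L_cplt e_mono e_join e_meet; split=> //; exists e; split=> // d'' M f.
exact: dense_extension.
Qed.

(** * Transport along order isomorphisms *)

Lemma complete_lattice_iso d d' (L : porderType d) (L' : porderType d')
    (h : L -> L') (k : L' -> L) :
  cancel k h -> order_embedding h -> complete_lattice L -> complete_lattice L'.
Proof.
move=> kK h_mono L_cplt; apply: complete_lattice_supremums => A.
have [m [mub mlub]] := (L_cplt (h @^-1` A)).1.
exists (h m); split=> [x Ax|x xub].
  by rewrite -(kK x) h_mono; apply: mub; rewrite /= kK.
by rewrite -(kK x) h_mono; apply: mlub => y /xub; rewrite -(kK x) h_mono kK.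
Qed.

Lemma is_DM_completion_iso d d' d'' (P : porderType d) (L : porderType d')
    (L' : porderType d'') (h : L -> L') (k : L' -> L) :
  cancel h k -> cancel k h -> order_embedding h ->
  is_DM_completion P L -> is_DM_completion P L'.
Proof.
move=> hK kK h_mono [L_cplt [e [e_mono e_univ]]].
split; first exact: complete_lattice_iso kK h_mono L_cplt.
exists (h \o e); split=> [p q|d3 M f M_cplt f_mono] /=.
  by rewrite h_mono e_mono.
have [g [g_mono ge]] := e_univ _ M f M_cplt f_mono.
exists (g \o k); split=> [x y|p] /=; last by rewrite hK; exact: ge.
by rewrite g_mono -h_mono !kK.
Qed.

Definition set_elem T (A : set T) x (Ax : A x) : A :=
  exist (fun y => y \in A) x (mem_set Ax).

(** * Lower and upper approximations *)

Section Approximations.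
Context {U : Type} (R : tolerance U).
Implicit Types (x y : U) (X Y A B C D : set U).

Local Notation "X ^v" := (lower R X) (at level 2, format "X ^v").
Local Notation "X ^^" := (upper R X) (at level 2, format "X ^^").

Lemma lower_sub X : X^v `<=` X.
Proof. by move=> x; apply; exact: tol_refl. Qed.

Lemma lowerS X Y : X `<=` Y -> X^v `<=` Y^v.
Proof. by move=> XY x xX; exact: subset_trans xX XY. Qed.

Lemma upperS X Y : X `<=` Y -> X^^ `<=` Y^^.
Proof. by move=> XY x [y [Rxy /XY Yy]]; exists y. Qed.

(** By symmetry of [R], both inclusions say that every neighbour of a point of [X] lies in [Y]. *)
Lemma upper_lower_adj X Y : X^^ `<=` Y <-> X `<=` Y^v.
Proof.
split=> [XY x Xx y Rxy|XY x [y [Rxy /XY]]].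
  by apply: XY; exists x; split=> //; exact: tol_sym.
by apply; exact: tol_sym.
Qed.

Lemma lowerC X : (~` X)^v = ~` X^^.
Proof.
apply/seteqP; split=> x H; first by case=> y [/H].
by move=> y Rxy Xy; apply: H; exists y.
Qed.

Lemma lower_upper_lower X : X^v^^^v = X^v.
Proof.
apply/seteqP; split; last exact/upper_lower_adj.
by apply: lowerS; exact/upper_lower_adj.
Qed.

(** Lower approximations are the closed sets of the closure operator given by the adjunction. *)
Lemma range_lowerE A : range (lower R) A <-> A^^^v = A.
Proof.
by split=> [[X _ <-]|<-]; [exact: lower_upper_lower | exists A^^].
Qed.

Lemma range_lower_bigcap I (P : set I) (F : I -> set U) :
  (forall i, P i -> range (lower R) (F i)) ->
  range (lower R) (\bigcap_(i in P) F i).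
Proof.
move=> Flow; apply/range_lowerE/seteqP; split; last exact/upper_lower_adj.
move=> x xF i Pi; have /range_lowerE <- := Flow i Pi.
by apply: lowerS x xF; apply: upperS; exact: bigcap_inf.
Qed.

Lemma singletons_lower x X : singletons R x -> X x -> X^v x.
Proof. by move=> Sx Xx; rewrite /lower /= Sx => _ ->. Qed.

(** * Joins and density in the disjoint representation, at the level of sets *)

Lemma disjoint_reprE A B :
  disjoint_repr R (A, B) <->
  [/\ A^^^v = A, B^^^v = B, A^^ `<=` ~` B^^ & singletons R `<=` A `|` B].
Proof.
by split=> -[/= /range_lowerE ? /range_lowerE ? /disjoints_subset ? ?].
Qed.

Lemma disjoint_repr_swap A B :
  disjoint_repr R (A, B) -> disjoint_repr R (B, A).
Proof. by move=> [/= Al Bl AB S]; split=> //=; rewrite 1?setIC 1?setUC. Qed.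

Lemma disjoint_repr_lower X : disjoint_repr R (X^v, (~` X)^v).
Proof.
apply/disjoint_reprE; split; [exact: lower_upper_lower..| |].
  apply: (@subset_trans _ X); first exact/upper_lower_adj.
  by apply: subsetCr; exact/upper_lower_adj.
move=> x Sx; have [Xx|nXx] := pselect (X x); [left|right];
  exact: singletons_lower.
Qed.

(** This pair will be the supremum of the family: the union has to be closed up, while the dual
    order turns the second component into an intersection. *)
Lemma disjoint_repr_bigcup I (P : set I) (A B : I -> set U) :
  (forall i, P i -> disjoint_repr R (A i, B i)) ->
  disjoint_repr R ((\bigcup_(i in P) A i)^^^v, \bigcap_(i in P) B i).
Proof.
move=> AB; apply/disjoint_reprE; split.
- exact: lower_upper_lower.
- by apply/range_lowerE/range_lower_bigcap => i /AB[].
- apply: (@subset_trans _ (\bigcup_(i in P) A i)^^).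
    exact/upper_lower_adj.
  (* The adjunction reduces disjointness to points of the union, and for a point of [A i] the
     disjointness of [A i] and [B i] suffices. *)
  apply/upper_lower_adj => x [i Pi Aix]; rewrite lowerC => xB.
  have /disjoint_reprE[_ _ /upper_lower_adj ABi _] := AB i Pi.
  have := ABi x Aix; rewrite lowerC; apply; apply: upperS xB.
  by apply: upperS; exact: bigcap_inf.
(* A point of [singletons R] outside the intersection misses some [B i], hence lies in that
   [A i]. *)
- move=> x Sx; have [Bx|] := pselect ((\bigcap_(i in P) B i) x); first by right.
  move=> /existsNP[i /not_implyP[Pi nBx]]; left; apply: singletons_lower => //.
  exists x; split; first exact: tol_refl.
  exists i => //; have /disjoint_reprE[_ _ _ /(_ x Sx)[]//] := AB i Pi.
Qed.

(* X = A^^ recovers A from below; for x outside B, take X to be the singleton of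
   a neighbour y of x outside B^^: its lower approximation is empty unless y lies
   in S (and then y = x is in A), so that x is not in D either. *)
Lemma disjoint_repr_join_dense A B C D :
  disjoint_repr R (A, B) ->
  (forall X, X^v `<=` A -> B `<=` (~` X)^v ->
     X^v `<=` C /\ D `<=` (~` X)^v) ->
  A `<=` C /\ D `<=` B.
Proof.
move=> /disjoint_reprE[Acl Bcl AB SAB] H; split.
  have [||] := H A^^; rewrite ?Acl //.
  by apply/upper_lower_adj; exact: subsetCr.
move=> x Dx; rewrite -Bcl => y Rxy; apply: contrapT => nBy.
have [||_ /(_ x Dx y Rxy)] := H [set y]; last exact.
- move=> z zy; have zE : z = y := lower_sub zy; subst z.
  have Sy : singletons R y.
    by apply/seteqP; split=> // _ ->; exact: tol_refl.
  case: (SAB y Sy) => // By; case: nBy.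
  by exists y; split=> //; exact: tol_refl.
- move=> b Bb z Rbz zE; have {}zE : z = y by []; subst z.
  apply: nBy; exists b; split=> //.
  exact: tol_sym.
Qed.

Lemma disjoint_repr_meet_dense A B C D :
  disjoint_repr R (C, D) ->
  (forall X, C `<=` X^v -> (~` X)^v `<=` D ->
     A `<=` X^v /\ (~` X)^v `<=` B) ->
  A `<=` C /\ D `<=` B.
Proof.
move=> /disjoint_repr_swap CD H.
have [|//] := disjoint_repr_join_dense (C := B) (D := A) CD.
by move=> X XD CX; have [||] := H (~` X); rewrite ?setCK.
Qed.

(** * Derivations expressed by approximations *)

Lemma derivationE X : derivation R X = ~` X^^.
Proof.
apply/seteqP; split=> x H; first by case=> y [Rxy /H]; apply; exact: tol_sym.
by move=> y Xy Ryx; apply: H; exists y; split=> //; exact: tol_sym.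
Qed.

(** Both closure operators agree, so extents of concepts and lower approximations are the same
    sets. *)
Lemma derivation2E X : derivation R (derivation R X) = X^^^v.
Proof. by rewrite !derivationE -lowerC setCK. Qed.

(** * The disjoint representation as a completion *)

Lemma le_RSE (p q : RS R) :
  (p <= q) <-> (val p).1 `<=` (val q).1 /\ (val p).2 `<=` (val q).2.
Proof. by rewrite -Order.le_val leEprod -!subsetEset; split=> /andP. Qed.

Lemma le_disjoint_reprE (p q : disjoint_repr R) :
  (p <= q) <-> (val p).1 `<=` (val q).1 /\ (val q).2 `<=` (val p).2.
Proof. by rewrite -Order.le_val leEprod -!subsetEset; split=> /andP. Qed.

Lemma disjoint_reprP (p : disjoint_repr R) :
  disjoint_repr R ((val p).1, (val p).2).
Proof. by have := set_mem (valP p); case: (val p). Qed.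

Lemma complete_lattice_disjoint_repr : complete_lattice (disjoint_repr R).
Proof.
apply: complete_lattice_supremums => F.
have mem := disjoint_repr_bigcup (fun p (_ : F p) => disjoint_reprP p).
exists (set_elem mem); split=> [p Fp|q qub].
  apply/le_disjoint_reprE; split=> /=; last exact: bigcap_inf.
  by apply/upper_lower_adj/upperS => x px; exists p.
apply/le_disjoint_reprE; split=> /=.
  (* The first component of the upper bound [q] is closed, so it contains the closure of any union
     it contains. *)
  have /disjoint_reprE[<- _ _ _] := disjoint_reprP q.
  by apply: lowerS; apply: upperS; apply: bigcup_sub
    => p /qub /le_disjoint_reprE[].
by apply: sub_bigcap => p /qub /le_disjoint_reprE[].
Qed.

Lemma RS_disjoint_subproof (p : RS R) :
  disjoint_repr R ((val p).1, ~` (val p).2).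
Proof.
have [X _ <-] := set_mem (valP p).
by rewrite -lowerC; exact: disjoint_repr_lower.
Qed.

Definition RS_disjoint (p : RS R) : disjoint_repr R :=
  set_elem (RS_disjoint_subproof p).

Definition rough X : RS R := set_elem (imageT (fun X => (X^v, X^^)) X).

Lemma is_DM_completion_disjoint_repr :
  is_DM_completion (RS R) (disjoint_repr R).
Proof.
apply: (@is_DM_completion_dense _ _ _ _ RS_disjoint).
- exact: complete_lattice_disjoint_repr.
- move=> p q; apply/idP/idP => [/le_disjoint_reprE[/= pq qp]|/le_RSE[pq qp]].
    by apply/le_RSE; split=> //; exact: subsetC2.
  by apply/le_disjoint_reprE; split=> //=; exact: subsetC.
- move=> l m lm; apply/le_disjoint_reprE.
  (* The image of [rough X] consists of the lower approximations of [X] and of its complement, so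
     [lm] is used at [rough X]. *)
  apply: (disjoint_repr_join_dense (disjoint_reprP l)) => X Xl lX.
  have /le_disjoint_reprE : RS_disjoint (rough X) <= m.
    by apply: lm; apply/le_disjoint_reprE; rewrite /= -lowerC.
  by rewrite /= -lowerC.
- move=> l m lm; apply/le_disjoint_reprE.
  apply: (disjoint_repr_meet_dense (disjoint_reprP m)) => X Xm mX.
  have /le_disjoint_reprE : l <= RS_disjoint (rough X).
    by apply: lm; apply/le_disjoint_reprE; rewrite /= -lowerC.
  by rewrite /= -lowerC.
Qed.

(** * Isomorphism with the formal concept representation *)

Lemma concept_eq (a b : concept R) : extent a = extent b -> a = b.
Proof. by move=> ab; apply/le_anti/andP; split; apply/asboolP; rewrite ab. Qed.

(** The least concept whose extent contains [X]. *)
Definition concept_gen X : concept R :=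
  Concept (derivation3 R X : derivation R (derivation R (derivation R X)) = _)
    erefl.

Lemma extent_gen X : extent (concept_gen X) = X^^^v.
Proof. exact: derivation2E. Qed.

Lemma extent_closed (a : concept R) : (extent a)^^^v = extent a.
Proof. by rewrite -derivation2E derivation_extent derivation_intent. Qed.

Lemma extent_weak_opposition (a : concept R) :
  extent (weak_opposition a) = (~` (extent a)^^)^v.
Proof. by rewrite /= -derivation_extent !derivationE setCK lowerC. Qed.

(** The bound by [weak_opposition a] is an inclusion into a lower approximation; the adjunction
    turns it into disjointness of the upper approximations of the extents. *)
Lemma formal_concept_reprE (a b : concept R) :
  formal_concept_repr R (a, b) <-> disjoint_repr R (extent a, extent b).
Proof.
rewrite disjoint_reprE /formal_concept_repr /=.
have -> : (b <= weak_opposition a) =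
    (extent b `<=` (~` (extent a)^^)^v) :> Prop.
  by rewrite -extent_weak_opposition; apply/propext; split=> /asboolP.
split=> [[ba S]|[_ _ ab S]]; split=> //; [exact: extent_closed..| |].
  by apply: subsetCr; exact/upper_lower_adj.
by apply/upper_lower_adj; exact: subsetCr.
Qed.

Lemma formal_of_disjoint_subproof (p : disjoint_repr R) :
  formal_concept_repr R (concept_gen (val p).1, concept_gen (val p).2).
Proof.
have pD := disjoint_reprP p; have /disjoint_reprE[cl1 cl2 _ _] := pD.
by apply/formal_concept_reprE; rewrite !extent_gen cl1 cl2.
Qed.

Definition formal_of_disjoint (p : disjoint_repr R) : formal_concept_repr R :=
  set_elem (formal_of_disjoint_subproof p).

Lemma disjoint_of_formal_subproof (p : formal_concept_repr R) :
  disjoint_repr R (extent (val p).1, extent (val p).2).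
Proof.
apply/formal_concept_reprE.
by have := set_mem (valP p); case: (val p).
Qed.

Definition disjoint_of_formal (p : formal_concept_repr R) : disjoint_repr R :=
  set_elem (disjoint_of_formal_subproof p).

Lemma formal_of_disjointK : cancel formal_of_disjoint disjoint_of_formal.
Proof.
move=> p; apply: val_inj => /=; rewrite !derivation2E.
have /disjoint_reprE[-> -> _ _] := disjoint_reprP p.
by case: p => -[].
Qed.

Lemma disjoint_of_formalK : cancel disjoint_of_formal formal_of_disjoint.
Proof.
move=> p; apply: val_inj; case: p => -[a b] ab /=.
by congr pair; apply: concept_eq; rewrite extent_gen extent_closed.
Qed.

(** Concepts are compared by their extents, and both representations reverse the order of the second
    component. *)
Lemma disjoint_of_formal_embedding : order_embedding disjoint_of_formal.
Proof.
move=> p q; apply/idP/idP => [/le_disjoint_reprE[pq qp]|].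
  by rewrite -Order.le_val leEprod; apply/andP; split; apply/asboolP.
rewrite -Order.le_val leEprod => /andP[/asboolP pq /asboolP qp].
exact/le_disjoint_reprE.
Qed.

Lemma formal_of_disjoint_embedding : order_embedding formal_of_disjoint.
Proof.
by move=> p q; rewrite -disjoint_of_formal_embedding !formal_of_disjointK.
Qed.

Lemma is_DM_completion_formal_concept_repr :
  is_DM_completion (RS R) (formal_concept_repr R).
Proof.
exact: is_DM_completion_iso formal_of_disjointK disjoint_of_formalK
  formal_of_disjoint_embedding is_DM_completion_disjoint_repr.
Qed.

End Approximations.

Theorem mainTheorem11 (U : Type) (R : tolerance U) :
  is_DM_completion (RS R) (disjoint_repr R) /\
  is_DM_completion (RS R) (formal_concept_repr R).
Proof.
split; first exact: is_DM_completion_disjoint_repr.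
exact: is_DM_completion_formal_concept_repr.
Qed.
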